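(* For every $(Q,c)\in\mathcal{S}^n\times\mathbb{R}^n$, strong duality holds between (RS) and (RS-D) (i.e., their optimal values are equal), and optimal solutions are attained in both (RS) and (RS-D).
   Context: Let $n \ge 1$, let $\mathcal{S}^n$ be the space of real symmetric $n\times n$ matrices, $e \in \mathbb{R}^n$ the all-ones vector, $\langle A,B\rangle = \mathrm{trace}(A^TB)$; inequalities $\ge,\le$ on vectors and matrices are componentwise, and $A\succeq0$ means positive semidefinite. Let $$\mathcal{F}_R = \{(x,X)\in\mathbb{R}^n\times\mathcal{S}^n : 0\le x\le e,\ \max\{x_i+x_j-1,0\}\le X_{ij}\le \min\{x_i,x_j\},\ 1\le i\le j\le n\},$$ $\mathcal{F}_{RS} = \{(x,X)\in\mathcal{F}_R : X-xx^T\succeq0\}$. The SDP-RLT relaxation is $$\text{(RS)}\quad \ell^*_{RS}=\min\{\tfrac12\langle Q,X\rangle+c^Tx : (x,X)\in\mathcal{F}_{RS}\}.$$ Its dual (RS-D) is the problem, over $(u,v,W,Y,Z,\beta,h,H)\in\mathbb{R}^n\times\mathbb{R}^n\times\mathcal{S}^n\times\mathbb{R}^{n\times n}\times\mathcal{S}^n\times\mathbb{R}\times\mathbb{R}^n\times\mathcal{S}^n$, of maximizing $-e^Tu-\frac12e^TWe-\frac12\beta$ subject to $$-u+v-We+Y^Te+h=c,\quad W-Y-Y^T+Z+H=Q,\quad u,v,W,Y,Z\ge0,\quad \begin{bmatrix} \beta & h^T \\ h & H \end{bmatrix}\succeq0.$$ *)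

(* Defs.v *)
From HB Require Import structures.
From mathcomp Require Import all_boot all_order all_algebra.
From mathcomp Require Import all_classical all_reals all_analysis.

Set Implicit Arguments.
Unset Strict Implicit.
Unset Printing Implicit Defensive.

Import Order.TTheory GRing.Theory Num.Theory.

Local Open Scope classical_set_scope.
Local Open Scope ring_scope.

Definition allones (R : realType) (n : nat) : 'cV[R]_n := const_mx 1.

Definition lemx (R : realType) (m n : nat) (A B : 'M[R]_(m, n)) : Prop :=
  forall i j, A i j <= B i j.

Definition innermx (R : realType) (m n : nat) (A B : 'M[R]_(m, n)) : R :=
  \tr (A^T *m B).

Definition psdmx (R : realType) (n : nat) (A : 'M[R]_n) : Prop :=
  A \is symmetricmx /\ forall z : 'cV[R]_n, 0 <= (z^T *m A *m z) 0 0.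

Definition FR (R : realType) (n : nat) : set ('cV[R]_n * 'M[R]_n) :=
  [set p | let: (x, X) := p in
    [/\ X \is symmetricmx,
        lemx 0 x /\ lemx x (allones R n)
      & forall i j : 'I_n, (i <= j)%N ->
          Num.max (x i 0 + x j 0 - 1) 0 <= X i j <= Num.min (x i 0) (x j 0)]].

Definition FRS (R : realType) (n : nat) : set ('cV[R]_n * 'M[R]_n) :=
  [set p | FR p /\ psdmx (p.2 - p.1 *m p.1^T)].

Definition RS_obj (R : realType) (n : nat) (Q : 'M[R]_n) (c : 'cV[R]_n)
    (p : 'cV[R]_n * 'M[R]_n) : R :=
  2^-1 * innermx Q p.2 + (c^T *m p.1) 0 0.

Definition RS_value (R : realType) (n : nat) (Q : 'M[R]_n) (c : 'cV[R]_n) :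
    \bar R :=
  ereal_inf [set (RS_obj Q c p)%:E | p in @FRS R n].

Record RSD_var (R : realType) (n : nat) : Type := RSDVar {
  du : 'cV[R]_n;
  dv : 'cV[R]_n;
  dW : 'M[R]_n;
  dY : 'M[R]_n;
  dZ : 'M[R]_n;
  dbeta : R;
  dh : 'cV[R]_n;
  dH : 'M[R]_n }.

Definition RSD_feasible (R : realType) (n : nat) (Q : 'M[R]_n) (c : 'cV[R]_n) :
    set (RSD_var R n) :=
  [set d | let: RSDVar u v W Y Z beta h H := d in
    let e := allones R n in
    [/\ [/\ W \is symmetricmx, Z \is symmetricmx & H \is symmetricmx],
        - u + v - W *m e + Y^T *m e + h = c,
        W - Y - Y^T + Z + H = Q,
        [/\ lemx 0 u, lemx 0 v, lemx 0 W, lemx 0 Y & lemx 0 Z]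
      & psdmx (block_mx beta%:M h^T h H : 'M[R]_(1 + n))]].

Definition RSD_obj (R : realType) (n : nat) (d : RSD_var R n) : R :=
  let e := allones R n in
  - (e^T *m du d) 0 0 - 2^-1 * (e^T *m dW d *m e) 0 0 - 2^-1 * dbeta d.

Definition RSD_value (R : realType) (n : nat) (Q : 'M[R]_n) (c : 'cV[R]_n) :
    \bar R :=
  ereal_sup [set (RSD_obj d)%:E | d in RSD_feasible Q c].

(* Main.v *)
Require Import Defs.
From HB Require Import structures.
From mathcomp Require Import all_boot all_order all_algebra.
From mathcomp Require Import all_classical all_reals all_analysis.
From mathcomp Require Import ring lra.

(** Write a pair (x, X) as the bordered matrix P = [1 x^T; x X].  Then X - x x^T
    is positive semidefinite iff P is, by a Schur complement.  If the rows of F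
    are the coefficient vectors of the affine forms 1, x_i and 1 - x_i, then the
    entries of F P F^T are the linearizations of all products of two of these
    forms, and the linear constraints of the relaxation say exactly that
    F P F^T >= 0 entrywise (lemma FRS_bordered).  Dually, the constraints of the
    dual problem say that [-2 obj, c^T; c, Q] = F^T L F + G, where L >= 0 is the
    symmetric matrix holding u, v, W, Y, Z, and G = [beta h^T; h H] is positive
    semidefinite (lemma rlt_combination).  The pair of problems thus becomes one
    statement about the cone of matrices F^T L F + G.

    Weak duality is <F^T L F + G, P> = <L, F P F^T> + <G, P> >= 0; the last term
    is nonnegative because a positive semidefinite G factors as a Gram matrix.
    The primal minimum exists because the feasible set is compact.

    Strong duality with dual attainment is a Farkas lemma for the cone of
    matrices F^T L F + G (conic_farkas).  Take a point of this cone nearest to a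
    given C.  The residual r is orthogonal to that nearest point and has a
    nonnegative inner product with the whole cone, so r itself is positive
    semidefinite with F r F^T >= 0.  If C has a nonnegative inner product with
    all such matrices, then |r|^2 = - <C, r> <= 0, so C lies in the cone.  The
    nearest point exists because the multipliers stay bounded, and this is where
    a Slater point is used: pairing with a strictly feasible P bounds the entries
    of L and the trace of G.

    For l the primal minimum, the Farkas lemma is applied to [-2l, c^T; c, Q].
    Its hypothesis is about the homogenized constraints, where the corner entry t
    of a matrix may vanish; adding the bordered matrix of an optimal point makes
    the corner t + 1 > 0 without changing the inner product, and the sum can then
    be rescaled to a feasible point. *)

Set Implicit Arguments.
Unset Strict Implicit.
Unset Printing Implicit Defensive.

Import Order.TTheory GRing.Theory Num.Theory.
Import numFieldNormedType.Exports.

Local Open Scope classical_set_scope.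
Local Open Scope ring_scope.

(** * The trace inner product *)

Section TraceForm.
Variable R : realType.

Lemma symmetricmxP n (A : 'M[R]_n) : A \is symmetricmx <-> A^T = A.
Proof.
split; last by move=> e; apply/is_hermitianmxP; rewrite expr0 scale1r map_mx_id ?e.
by move/is_hermitianmxP; rewrite expr0 scale1r map_mx_id // => e; rewrite -e.
Qed.

Lemma innermxE m n (A B : 'M[R]_(m, n)) :
  innermx A B = \sum_i \sum_j A i j * B i j.
Proof.
rewrite /innermx /mxtrace exchange_big /=; apply: eq_bigr => j _.
by rewrite mxE; apply: eq_bigr => i _; rewrite mxE.
Qed.

Lemma innermxC m n (A B : 'M[R]_(m, n)) : innermx A B = innermx B A.
Proof.
by rewrite !innermxE; apply: eq_bigr => i _; apply: eq_bigr => j _; rewrite mulrC.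
Qed.

Lemma innermxDl m n (A B C : 'M[R]_(m, n)) :
  innermx (A + B) C = innermx A C + innermx B C.
Proof. by rewrite /innermx linearD mulmxDl linearD. Qed.

Lemma innermxZl m n a (A B : 'M[R]_(m, n)) :
  innermx (a *: A) B = a * innermx A B.
Proof. by rewrite /innermx linearZ -scalemxAl mxtraceZ. Qed.

Lemma innermxDr m n (A B C : 'M[R]_(m, n)) :
  innermx A (B + C) = innermx A B + innermx A C.
Proof. by rewrite !(innermxC A) innermxDl. Qed.

Lemma innermxZr m n a (A B : 'M[R]_(m, n)) :
  innermx A (a *: B) = a * innermx A B.
Proof. by rewrite !(innermxC A) innermxZl. Qed.

Lemma innermxNl m n (A B : 'M[R]_(m, n)) : innermx (- A) B = - innermx A B.
Proof. by rewrite -scaleN1r innermxZl mulN1r. Qed.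

Lemma innermxNr m n (A B : 'M[R]_(m, n)) : innermx A (- B) = - innermx A B.
Proof. by rewrite !(innermxC A) innermxNl. Qed.

Lemma innermx_ge0 m n (A : 'M[R]_(m, n)) : 0 <= innermx A A.
Proof.
rewrite innermxE; apply: sumr_ge0 => i _; apply: sumr_ge0 => j _.
by rewrite -expr2 sqr_ge0.
Qed.

Lemma innermx_le0_eq0 m n (A : 'M[R]_(m, n)) : innermx A A <= 0 -> A = 0.
Proof.
move=> A0; have /eqP : innermx A A = 0 by apply: le_anti; rewrite A0 innermx_ge0.
rewrite innermxE psumr_eq0; last first.
  by move=> i _; apply: sumr_ge0 => j _; rewrite -expr2 sqr_ge0.
move=> /allP Ai; apply/matrixP => i j; rewrite mxE.
have /implyP/(_ isT) := Ai i (mem_index_enum _).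
rewrite psumr_eq0; last by move=> k _; rewrite -expr2 sqr_ge0.
by move=> /allP/(_ j (mem_index_enum _))/implyP/(_ isT); rewrite mulf_eq0 orbb => /eqP.
Qed.

(** The congruences by F and by F^T are adjoint; this is what moves a constraint
    on F P F^T to the multiplier side. *)
Lemma innermx_congr m n (F : 'M[R]_(m, n)) (L : 'M[R]_m) (P : 'M[R]_n) :
  innermx (F^T *m L *m F) P = innermx L (F *m P *m F^T).
Proof.
by rewrite /innermx !trmx_mul trmxK -!mulmxA mxtrace_mulC -!mulmxA.
Qed.

Lemma innermx_nonneg m n (A B : 'M[R]_(m, n)) :
  lemx 0 A -> lemx 0 B -> 0 <= innermx A B.
Proof.
move=> A0 B0; rewrite innermxE; apply: sumr_ge0 => i _; apply: sumr_ge0 => j _.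
by apply: mulr_ge0; [have := A0 i j|have := B0 i j]; rewrite mxE.
Qed.

Lemma innermx_block m1 m2 n1 n2 (A A' : 'M[R]_(m1, n1)) (B B' : 'M[R]_(m1, n2))
    (C C' : 'M[R]_(m2, n1)) (D D' : 'M[R]_(m2, n2)) :
  innermx (block_mx A B C D) (block_mx A' B' C' D') =
  innermx A A' + innermx B B' + innermx C C' + innermx D D'.
Proof.
rewrite /innermx tr_block_mx mulmx_block mxtrace_block !linearD /=; ring.
Qed.

End TraceForm.

(** * Positive semidefinite matrices *)

Section Psd.
Variable R : realType.

(** A first-order optimality condition: near s = 0 the linear term dominates. *)
Lemma linear_quadratic_ge0 (a b : R) :
  (forall s, 0 < s -> s <= 1 -> 0 <= 2 * s * a + s ^+ 2 * b) -> 0 <= a.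
Proof.
move=> H; rewrite leNgt; apply/negP => a0.
have b1 : 0 < 1 + `|b| - a by have := normr_ge0 b; lra.
have bB := ler_norm b.
(* This step lies in (0, 1] and satisfies s * b < - 2 * a. *)
pose s := - a / (1 + `|b| - a).
have s0 : 0 < s by rewrite divr_gt0 // oppr_gt0.
have s1 : s <= 1 by rewrite ler_pdivrMr //; have := normr_ge0 b; lra.
have := H s s0 s1.
have -> : 2 * s * a + s ^+ 2 * b = s * (2 * a + s * b) by ring.
rewrite pmulr_rge0 //.
have -> : s * b = (- a) * (b / (1 + `|b| - a)) by rewrite /s; ring.
have : b / (1 + `|b| - a) <= 1 by rewrite ler_pdivrMr //; lra.
by nra.
Qed.

Lemma mulmx11 (a b : 'M[R]_1) : (a *m b) 0 0 = a 0 0 * b 0 0.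
Proof. by rewrite mxE big_ord1. Qed.

Lemma addmx11 (a b : 'M[R]_1) : (a + b) 0 0 = a 0 0 + b 0 0.
Proof. by rewrite mxE. Qed.

Lemma oppmx11 (a : 'M[R]_1) : (- a) 0 0 = - a 0 0.
Proof. by rewrite mxE. Qed.

Lemma scalemx11 k (a : 'M[R]_1) : (k *: a) 0 0 = k * a 0 0.
Proof. by rewrite mxE. Qed.

Lemma mx11_tr (a : 'M[R]_1) : a^T = a.
Proof. by apply/matrixP => i j; rewrite !ord1 mxE. Qed.

Lemma quad_block n (a s : 'M[R]_1) (b y : 'cV[R]_n) (D : 'M[R]_n) :
  ((col_mx s y)^T *m block_mx a b^T b D *m col_mx s y) 0 0 =
  a 0 0 * s 0 0 ^+ 2 + 2 * s 0 0 * (b^T *m y) 0 0 + (y^T *m D *m y) 0 0.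
Proof.
have yb : (y^T *m b) 0 0 = (b^T *m y) 0 0.
  by rewrite -[y^T *m b]mx11_tr trmx_mul trmxK.
rewrite tr_col_mx mul_row_block mul_row_col !mulmxDl -(mulmxA _ b^T).
rewrite !addmx11 !mulmx11 mx11_tr yb; ring.
Qed.

Lemma psdmxD n (A B : 'M[R]_n) : psdmx A -> psdmx B -> psdmx (A + B).
Proof.
move=> [sA A0] [sB B0]; split.
  by apply/symmetricmxP; rewrite linearD /= (symmetricmxP A).1 // (symmetricmxP B).1.
by move=> z; rewrite mulmxDr mulmxDl mxE addr_ge0.
Qed.

Lemma psdmxZ n a (A : 'M[R]_n) : 0 <= a -> psdmx A -> psdmx (a *: A).
Proof.
move=> a0 [sA A0]; split.
  by apply/symmetricmxP; rewrite linearZ /= (symmetricmxP A).1.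
by move=> z; rewrite -scalemxAr -scalemxAl mxE mulr_ge0.
Qed.

Lemma psdmx_gram m n (B : 'M[R]_(m, n)) : psdmx (B *m B^T).
Proof.
split; first by apply/symmetricmxP; rewrite trmx_mul trmxK.
move=> z; rewrite -mulmxA -mulmxA mulmxA.
have -> : z^T *m B = (B^T *m z)^T by rewrite trmx_mul trmxK.
by rewrite mxE; apply: sumr_ge0 => i _; rewrite !mxE -expr2 sqr_ge0.
Qed.

Lemma psdmx0 n : psdmx (0 : 'M[R]_n).
Proof. by have := psdmx_gram (0 : 'M[R]_n); rewrite mul0mx. Qed.

(** What positivity of a bordered matrix says about its blocks; the inductive step
    of the Cholesky factorization.  A zero corner kills its row, since a quadratic
    form that is affine along a direction must be constant there; a positive
    corner is eliminated by minimizing over the first coordinate. *)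
Lemma psdmx_schur n (a : 'M[R]_1) (b : 'cV[R]_n) (D : 'M[R]_n) :
  psdmx (block_mx a b^T b D) ->
  [/\ 0 <= a 0 0, D^T = D,
      forall y : 'cV_n, 0 <= (y^T *m D *m y) 0 0,
      a 0 0 = 0 -> b = 0
    & 0 < a 0 0 -> psdmx (D - (a 0 0)^-1 *: (b *m b^T))].
Proof.
move=> [sA A0].
have DT : D^T = D.
  by move/symmetricmxP: sA; rewrite tr_block_mx => /eq_block_mx [].
have quad s (y : 'cV_n) : 0 <= a 0 0 * s ^+ 2 + 2 * s * (b^T *m y) 0 0 + (y^T *m D *m y) 0 0.
  by have := A0 (col_mx s%:M y); rewrite quad_block mxE eqxx mulr1n.
have D0 (y : 'cV_n) : 0 <= (y^T *m D *m y) 0 0.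
  by have := quad 0 y; rewrite expr0n /= mulr0 mulr0 mul0r !add0r.
split => //.
- by have := quad 1 0; rewrite !mulmx0 mxE; lra.
- move=> a0; have bb : (b^T *m b) 0 0 <= 0.
    (* With a zero corner, test the form at (- 1 / s, b) for small s. *)
    rewrite -oppr_ge0; set N : R := (b^T *m b) 0 0; set q : R := (b^T *m D *m b) 0 0.
    apply: (@linear_quadratic_ge0 _ q) => s s0 _.
    have := quad (- 1 / s) b; rewrite a0 mul0r add0r -/N -/q.
    move=> /(mulr_ge0 (ltW (exprn_gt0 2 s0))).
    suff -> : s ^+ 2 * (2 * (- 1 / s) * N + q) = 2 * s * - N + s ^+ 2 * q by [].
    by field; rewrite gt_eqF.
  by apply: innermx_le0_eq0; rewrite /innermx /mxtrace big_ord1.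
- move=> a_gt0; split.
    apply/symmetricmxP; rewrite linearB /= linearZ /= trmx_mul trmxK.
    by congr (_ - _).
  move=> y; set B : R := (b^T *m y) 0 0.
  (* The first coordinate - B / a minimizes the form for fixed y. *)
  have := quad (- B / a 0 0) y; rewrite -/B.
  rewrite mulmxBr mulmxBl -scalemxAr -scalemxAl addmx11 oppmx11 scalemx11.
  have -> : (y^T *m (b *m b^T) *m y) 0 0 = B * B.
    rewrite mulmxA -mulmxA mulmx11 -/B; congr (_ * _).
    by rewrite -[y^T *m b]mx11_tr trmx_mul trmxK.
  suff -> : a 0 0 * (- B / a 0 0) ^+ 2 + 2 * (- B / a 0 0) * B =
    - ((a 0 0)^-1 * (B * B)) by rewrite addrC.
  by field; rewrite gt_eqF.
Qed.

(** Cholesky factorization. *)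
Lemma psdmx_factor n (A : 'M[R]_n) : psdmx A -> exists L : 'M[R]_n, A = L *m L^T.
Proof.
elim: n A => [|n IH] A pA.
  by exists 0; apply/matrixP => -[].
pose b := @dlsubmx _ 1 n 1 n A; pose a := @ulsubmx _ 1 n 1 n A.
pose D := @drsubmx _ 1 n 1 n A.
have AE : A = block_mx a b^T b D.
  have -> : b^T = @ursubmx _ 1 n 1 n A.
    by rewrite -[in RHS]((symmetricmxP A).1 pA.1) -trmx_dlsub.
  exact/esym/(@submxK _ 1 n 1 n).
move: pA; rewrite AE.
move=> pB; have [a0 DT D0 b0 Spsd] := psdmx_schur pB.
change (exists L : 'M[R]_(1 + n), block_mx a b^T b D = L *m L^T).
have aE : a = (a 0 0)%:M.
  by apply/matrixP => i j; rewrite !ord1 [RHS]mxE eqxx mulr1n.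
have [az|anz] := eqVneq (a 0 0) 0.
  have [|M DM] := IH D; first by split => //; apply/symmetricmxP.
  exists (block_mx 0 0 0 M).
  rewrite tr_block_mx mulmx_block !trmx0 !mulmx0 !mul0mx !add0r b0 // trmx0 -DM.
  by rewrite aE az raddf0.
have ap : 0 < a 0 0 by rewrite lt_def anz a0.
have [M SM] := IH _ (Spsd ap).
set r := Num.sqrt (a 0 0).
have r0 : r != 0 by rewrite gt_eqF // sqrtr_gt0.
have rr : r * r = a 0 0 by rewrite -expr2 sqr_sqrtr.
exists (block_mx r%:M 0 (r^-1 *: b) M).
rewrite tr_block_mx mulmx_block !trmx0 !mulmx0 !mul0mx !addr0.
rewrite tr_scalar_mx -scalar_mxM rr -aE linearZ /= mul_scalar_mx mul_mx_scalar.
rewrite !scalerA mulfV // !scale1r -SM -scalemxAl -scalemxAr scalerA -invfM rr.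
by rewrite addrC subrK.
Qed.

Lemma innermx_gram m n (B : 'M[R]_(n, m)) (P : 'M[R]_n) :
  innermx (B *m B^T) P = \sum_j ((col j B)^T *m P *m col j B) 0 0.
Proof.
have := innermx_congr B^T 1%:M P; rewrite trmxK mulmx1 => ->.
rewrite /innermx trmx1 mul1mx; apply: eq_bigr => j _.
by rewrite tr_col -row_mul mxE [RHS]mxE; apply: eq_bigr => k _; rewrite !mxE.
Qed.

(** The semidefinite cone is contained in its own dual: the inner product with
    a Gram matrix is a sum of values of the quadratic form at its columns. *)
Lemma innermx_psdmx_ge0 n (A P : 'M[R]_n) : psdmx A -> psdmx P -> 0 <= innermx A P.
Proof.
move=> /psdmx_factor [L ->] [_ P0]; rewrite innermx_gram.
by apply: sumr_ge0 => j _; exact: P0.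
Qed.

Lemma quad_delta n (A : 'M[R]_n) (i j : 'I_n) :
  ((delta_mx i 0 : 'cV_n)^T *m A *m (delta_mx j 0 : 'cV_n)) 0 0 = A i j.
Proof.
by rewrite trmx_delta -rowE mxE (bigD1 j) //= big1 ?addr0 => [|k kj];
  rewrite !mxE ?eqxx ?mulr1 // (negPf kj) mulr0.
Qed.

Lemma psdmx_diag_ge0 n (A : 'M[R]_n) i : psdmx A -> 0 <= A i i.
Proof. by move=> [_ /(_ (delta_mx i 0))]; rewrite quad_delta. Qed.

(** Bounding the trace bounds a positive semidefinite matrix, because its 2 x 2
    principal forms at (1, 1) and (1, -1) are nonnegative. *)
Lemma psdmx_entry_le n (A : 'M[R]_n) i j :
  psdmx A -> `|A i j| <= \tr A.
Proof.
move=> pA; have [sA A0] := pA; have d k := psdmx_diag_ge0 k pA.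
have Aji : A j i = A i j by rewrite -{1}((symmetricmxP A).1 sA) mxE.
have le_tr k : A k k <= \tr A.
  by rewrite /mxtrace (bigD1 k) //= lerDl sumr_ge0.
have q s : 0 <= A i i + 2 * s * A i j + s ^+ 2 * A j j.
  have := A0 (delta_mx i 0 + s *: delta_mx j 0).
  have -> : (delta_mx i 0 + s *: delta_mx j 0 : 'cV[R]_n)^T =
    (delta_mx i 0)^T + s *: (delta_mx j 0)^T by rewrite linearD linearZ.
  rewrite !(mulmxDl, mulmxDr) -!scalemxAl -!scalemxAr.
  by rewrite !(addmx11, scalemx11) !quad_delta Aji; lra.
have := q 1; have := q (- 1); have := le_tr i; have := le_tr j.
by rewrite ler_norml; lra.
Qed.

End Psd.

(** * Compactness and continuity for matrices *)

Section MatrixTopology.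
Variable R : realType.

Lemma mx_continuous (T : topologicalType) m n (f : T -> 'M[R]_(m, n)) :
  (forall i j, continuous (fun x => f x i j)) -> continuous f.
Proof.
move=> fc x; apply/cvg_ballP => e e0.
have fe : \forall y \near x, forall i j, ball (f x i j) e (f y i j).
  apply: filter_forall => i; apply: filter_forall => j.
  by have /cvg_ballP := fc i j x; exact.
by apply: filterS fe => y fy; split.
Qed.

Lemma continuous_mxsum (T : topologicalType) (I : finType) (F : I -> T -> R) :
  (forall i, continuous (F i)) -> continuous (fun x => \sum_i F i x).
Proof.
move=> Fc; apply: continuous_big => // -[a b].
exact: (@add_continuous R^o).
Qed.

Lemma continuous_innermx (T : topologicalType) m n (f g : T -> 'M[R]_(m, n)) :
  continuous f -> continuous g -> continuous (fun x => innermx (f x) (g x)).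
Proof.
move=> fc gc.
rewrite [X in continuous X](_ : _ = fun x => \sum_i \sum_j f x i j * g x i j);
  last by apply/funext => x; rewrite innermxE.
apply: continuous_mxsum => i; apply: continuous_mxsum => j x.
apply: continuousM; apply: continuous_comp (@coord_continuous _ _ _ _ _ _).
  exact: fc.
exact: gc.
Qed.

Lemma continuous_mulmx (T : topologicalType) m n p
    (f : T -> 'M[R]_(m, n)) (g : T -> 'M[R]_(n, p)) :
  continuous f -> continuous g -> continuous (fun x => f x *m g x).
Proof.
move=> fc gc; apply: mx_continuous => i j.
rewrite [X in continuous X](_ : _ = fun x => \sum_k f x i k * g x k j);
  last by apply/funext => x; rewrite mxE.
apply: continuous_mxsum => k x.
apply: continuousM; apply: continuous_comp (@coord_continuous _ _ _ _ _ _).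
  exact: fc.
exact: gc.
Qed.

(** Heine-Borel for matrices: a box of matrices is the continuous image under
    vec_mx of a box of row vectors. *)
Lemma compact_mx m n (A : set 'M[R]_(m, n)) (B : R) :
  closed A -> (forall M, A M -> forall i j, `|M i j| <= B) -> compact A.
Proof.
move=> Acl AB.
have cbox : compact [set v : 'rV[R]_(m * n) | forall k, `[- B, B]%classic (v ord0 k)].
  by apply: (@rV_compact _ _ (fun=> `[- B, B]%classic)) => k; exact: segment_compact.
have vc : continuous (@vec_mx R m n).
  apply: mx_continuous => i j.
  rewrite [X in continuous X](_ : _ = fun v : 'rV[R]_(m * n) => v ord0 (mxvec_index i j)).
    exact: coord_continuous.
  by apply/funext => v; rewrite mxE.
apply: (subclosed_compact Acl (continuous_compact (continuous_subspaceT vc) cbox)).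
move=> M AM.
exists (mxvec M); last exact: mxvecK.
move=> k; case/mxvec_indexP: k => i j; rewrite mxvecE /= in_itv /= -ler_norml.
exact: AB.
Qed.

Lemma closed_forall (T : topologicalType) I (P : I -> T -> Prop) :
  (forall i, closed [set x | P i x]) -> closed [set x | forall i, P i x].
Proof.
move=> Pc; rewrite [X in closed X](_ : _ = \bigcap_(i in setT) [set x | P i x]).
  exact: closed_bigI.
by apply/seteqP; split => [x Px i _|x Px i]; [exact: Px|exact: (Px i)].
Qed.

Lemma closed_ge0 (T : topologicalType) (f : T -> R) :
  continuous f -> closed [set x | 0 <= f x].
Proof.
move=> fc; apply: (@preimage_closed _ _ f [set y | 0 <= y]) => [x _|].
  exact: fc.
exact: closed_ge.
Qed.

Lemma closed_lec (T : topologicalType) (f : T -> R) b :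
  continuous f -> closed [set x | f x <= b].
Proof.
move=> fc; apply: (@preimage_closed _ _ f [set y | y <= b]) => [x _|].
  exact: fc.
exact: closed_le.
Qed.

Lemma closed_eq0 (T : topologicalType) (f : T -> R) :
  continuous f -> closed [set x | f x = 0].
Proof.
move=> fc; apply: (@preimage_closed _ _ f [set y | y = 0]) => [x _|].
  exact: fc.
exact: closed_eq.
Qed.

Lemma closed_lemx0 m n : closed [set A : 'M[R]_(m, n) | lemx 0 A].
Proof.
apply: closed_forall => i; apply: closed_forall => j.
rewrite [X in closed X](_ : _ = [set A : 'M[R]_(m, n) | 0 <= A i j]).
  by apply: closed_ge0; exact: coord_continuous.
by apply/seteqP; split => A /=; rewrite mxE.
Qed.

Lemma closed_symmetricmx n : closed [set A : 'M[R]_n | A^T = A].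
Proof.
rewrite [X in closed X](_ : _ = [set A : 'M[R]_n | forall i j, A j i - A i j = 0]).
  do 2!apply: closed_forall => ?; apply: closed_eq0 => x.
  by apply: continuousB; exact: coord_continuous.
apply/seteqP; split => [A AT i j|A AT] /=.
  by rewrite -{1}AT mxE subrr.
by apply/matrixP => i j; rewrite mxE; apply/eqP; rewrite -subr_eq0 AT.
Qed.

Lemma closed_psdmx n : closed [set A : 'M[R]_n | psdmx A].
Proof.
apply: closedI.
  rewrite [X in closed X](_ : _ = [set A : 'M[R]_n | A^T = A]).
    exact: closed_symmetricmx.
  by apply/seteqP; split => A /symmetricmxP.
apply: closed_forall => z; apply: closed_ge0 => A.
apply: (@continuous_comp _ _ _ (fun A => z^T *m A *m z) (fun M : 'M[R]_1 => M 0 0)).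
  apply: continuous_mulmx => [|B]; last exact: cst_continuous.
  by apply: continuous_mulmx => B; [exact: cst_continuous|exact: cvg_id].
exact: coord_continuous.
Qed.

End MatrixTopology.

(** * A Farkas lemma for semidefinite cones with linear constraints *)

Section Farkas.
Variable R : realType.

Lemma lemx0P m n (A : 'M[R]_(m, n)) : lemx 0 A <-> forall i j, 0 <= A i j.
Proof. by split => A0 i j; have := A0 i j; rewrite mxE. Qed.

Lemma entry_le_innermx1 m n (L : 'M[R]_(m, n)) i j :
  lemx 0 L -> L i j <= innermx L (const_mx 1).
Proof.
move=> /lemx0P L0; rewrite innermxE (bigD1 i) //= (bigD1 j) //= !mxE mulr1 -addrA.
rewrite lerDl addr_ge0 //; first by apply: sumr_ge0 => l _; rewrite mxE mulr1.
by apply: sumr_ge0 => l _; apply: sumr_ge0 => p _; rewrite mxE mulr1.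
Qed.

Lemma innermx_idr n (A : 'M[R]_n) : innermx A 1%:M = \tr A.
Proof. by rewrite /innermx mulmx1 mxtrace_tr. Qed.

(** The multipliers are kept symmetric so that the residual of the nearest point
    is symmetric, as positive semidefiniteness requires. *)
Definition in_dual_cone k m (d : 'M[R]_k * 'M[R]_m) : Prop :=
  [/\ d.1^T = d.1, lemx 0 d.1 & psdmx d.2].

Definition cone_image k m (F : 'M[R]_(k, m)) (d : 'M[R]_k * 'M[R]_m) : 'M[R]_m :=
  F^T *m d.1 *m F + d.2.

Lemma in_dual_coneD k m (d d' : 'M[R]_k * 'M[R]_m) s :
  0 <= s -> in_dual_cone d -> in_dual_cone d' ->
  in_dual_cone (d.1 + s *: d'.1, d.2 + s *: d'.2).
Proof.
move=> s0 [dT d0 dp] [dT' d0' dp']; split => /=.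
- by rewrite linearD linearZ /= dT dT'.
- apply/lemx0P => i j; rewrite !mxE.
  by rewrite addr_ge0 ?mulr_ge0 // ?((lemx0P _).1 d0) ?((lemx0P _).1 d0').
- by apply: psdmxD => //; exact: psdmxZ.
Qed.

Lemma in_dual_coneZ k m (d : 'M[R]_k * 'M[R]_m) s :
  0 <= s -> in_dual_cone d -> in_dual_cone (s *: d.1, s *: d.2).
Proof.
move=> s0 [dT d0 dp]; split => /=.
- by rewrite linearZ /= dT.
- by apply/lemx0P => i j; rewrite !mxE mulr_ge0 // ((lemx0P _).1 d0).
- exact: psdmxZ.
Qed.

Lemma innermxDZ n (A B : 'M[R]_n) s :
  innermx (A + s *: B) (A + s *: B) =
  innermx A A + (2 * s * innermx A B + s ^+ 2 * innermx B B).
Proof.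
rewrite !innermxDl !innermxDr !innermxZl !innermxZr (innermxC B A); ring.
Qed.

(** The Slater point P controls both multipliers at once: P - 1 is positive
    semidefinite, so pairing with P dominates the trace of G, and F P F^T >= 1, so
    it dominates the sum of the entries of L.  The margin 1 costs no generality,
    since the constraints on P are homogeneous. *)
Lemma cone_image_bound k m (F : 'M[R]_(k, m)) (P : 'M[R]_m) d :
  psdmx (P - 1%:M) -> lemx (const_mx 1) (F *m P *m F^T) -> in_dual_cone d ->
  innermx d.1 (const_mx 1) + \tr d.2 <= innermx (cone_image F d) P.
Proof.
move=> pP FP [_ d0 dp]; rewrite innermxDl innermx_congr.
apply: lerD.
  rewrite -subr_ge0 -innermxNr -innermxDr innermx_nonneg //.
  by apply/lemx0P => i j; have := FP i j; rewrite !mxE subr_ge0.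
by rewrite -subr_ge0 -innermx_idr -innermxNr -innermxDr innermx_psdmx_ge0.
Qed.

(** The cone is unbounded, but any pair at least as good as 0 has multipliers
    bounded through the Slater point, so the search is over a compact set. *)
Lemma dual_cone_nearest k m (F : 'M[R]_(k, m)) (C P : 'M[R]_m) :
  psdmx (P - 1%:M) -> lemx (const_mx 1) (F *m P *m F^T) ->
  exists2 d, in_dual_cone d & forall d', in_dual_cone d' ->
    let dist d := innermx (cone_image F d - C) (cone_image F d - C) in
    dist d <= dist d'.
Proof.
move=> pP FP; pose dist d := innermx (cone_image F d - C) (cone_image F d - C).
have inc0 : in_dual_cone (0 : 'M[R]_k * 'M[R]_m).
  split => /=; [exact: trmx0|by apply/lemx0P => i j; rewrite mxE|exact: psdmx0].
have dist0 : dist 0 = innermx C C.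
  by rewrite /dist /cone_image mulmx0 mul0mx addr0 sub0r innermxNl innermxNr opprK.
(* A rounding up of the bound on the inner product of P with any matrix D such
   that |D - C| <= |C|, by the arithmetic-geometric mean inequality. *)
pose b := innermx C P + (innermx C C + innermx P P).
have bound d : in_dual_cone d -> dist d <= dist 0 ->
    innermx d.1 (const_mx 1) <= b /\ \tr d.2 <= b.
  move=> dK dd; have := cone_image_bound pP FP dK; rewrite -[cone_image F d](subrK C).
  rewrite innermxDl; have [_ d0 dp] := dK.
  have : 0 <= innermx d.1 (const_mx 1).
    by apply: innermx_nonneg => //; apply/lemx0P => i j; rewrite mxE.
  have : 0 <= \tr d.2 by apply: sumr_ge0 => i _; exact: psdmx_diag_ge0.
  have := innermx_ge0 (cone_image F d - C + -1 *: P); rewrite innermxDZ -/(dist d).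
  have := innermx_ge0 C; have := innermx_ge0 P; rewrite /b; lra.
pose KL : set 'M[R]_k := [set L | L^T = L] `&`
  ([set L | lemx 0 L] `&` [set L | innermx L (const_mx 1) <= b]).
pose KG : set 'M[R]_m := [set G | psdmx G] `&` [set G | \tr G <= b].
have cL : compact KL.
  apply: (@compact_mx _ _ _ _ b) => [|L [_ [L0 Lb]] i j].
    apply: closedI; first exact: closed_symmetricmx.
    apply: closedI; first exact: closed_lemx0.
    apply: closed_lec; apply: continuous_innermx => A; first exact: cvg_id.
    exact: cst_continuous.
  by rewrite ger0_norm ?((lemx0P _).1 L0) // (le_trans (entry_le_innermx1 _ _ L0)).
have cG : compact KG.
  apply: (@compact_mx _ _ _ _ b) => [|G [pG Gb] i j].
    apply: closedI; first exact: closed_psdmx.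
    rewrite [X in closed X](_ : _ = [set G | innermx G 1%:M <= b]); last first.
      by apply/seteqP; split => G /=; rewrite innermx_idr.
    apply: closed_lec; apply: continuous_innermx => A; first exact: cvg_id.
    exact: cst_continuous.
  by rewrite (le_trans (psdmx_entry_le i j pG)).
have K0 : (KL `*` KG) 0.
  have [i0 i1 i2] := inc0; have [b1 b2] := bound _ inc0 (lexx _).
  by split; split.
have distc : continuous dist.
  have imc : continuous (fun d => cone_image F d - C).
    move=> d; apply: continuousB; last exact: cst_continuous.
    apply: continuousD; last exact: cvg_snd.
    apply: continuous_mulmx; last exact: cst_continuous.
    by apply: continuous_mulmx; [exact: cst_continuous|move=> ?; exact: cvg_fst].
  by apply: continuous_innermx.
have [|d] := @compact_EVT_min _ _ dist _ (ex_intro _ 0 K0) (compact_setX cL cG).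
  exact: continuous_subspaceT.
rewrite inE => -[[dT [d0 db]] [dp db']] dmin.
exists d => [|d' d'K]; first by split.
have [le0|/ltW] := leP (dist d') (dist 0).
  have [b1 b2] := bound _ d'K le0; have [? ? ?] := d'K.
  by apply: dmin; rewrite inE; split; split.
by apply: le_trans; apply: dmin; rewrite inE.
Qed.

(** Farkas lemma for the cone of matrices F^T L F + G: under a Slater condition
    the cone is closed and therefore equals its bidual.  The residual r of the
    nearest point to C is shown to be an admissible X; testing the hypothesis on C
    at X = r forces r = 0. *)
Theorem conic_farkas k m (F : 'M[R]_(k, m)) (C P : 'M[R]_m) :
  psdmx (P - 1%:M) -> lemx (const_mx 1) (F *m P *m F^T) -> C^T = C ->
  (forall X, psdmx X -> lemx 0 (F *m X *m F^T) -> 0 <= innermx C X) ->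
  exists L G, [/\ L^T = L, lemx 0 L, psdmx G & C = F^T *m L *m F + G].
Proof.
move=> pP FP CT C0; have [d dK dmin] := dual_cone_nearest C pP FP.
pose D := cone_image F d; pose r := D - C.
have [dT d0 dp] := dK.
have rT : r^T = r.
  rewrite /r /D /cone_image linearB linearD /= !trmx_mul trmxK dT mulmxA CT.
  by rewrite (symmetricmxP _).1 //; case: dp.
(* A move along E that stays in the cone cannot shorten the residual.  The moves
   used are along the cone itself and along - D, towards 0. *)
have descent E : (forall s, 0 < s -> s <= 1 -> exists2 d', in_dual_cone d' &
    cone_image F d' - C = r + s *: E) -> 0 <= innermx r E.
  move=> dir; apply: (@linear_quadratic_ge0 _ _ (innermx E E)) => s s0 s1.
  have [d' d'K d'E] := dir s s0 s1; have := dmin d' d'K.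
  by rewrite /= d'E innermxDZ -/D -/r lerDl.
have dir_cone d' : in_dual_cone d' -> 0 <= innermx r (cone_image F d').
  move=> d'K; apply: descent => s s0 _.
  exists (d.1 + s *: d'.1, d.2 + s *: d'.2); first exact: in_dual_coneD (ltW s0) dK d'K.
  rewrite /r /D /cone_image /= mulmxDr mulmxDl -scalemxAr -scalemxAl scalerDr.
  by rewrite addrACA [LHS]addrAC.
have rD : innermx r D <= 0.
  rewrite -oppr_ge0 -innermxNr; apply: descent => s s0 s1.
  exists ((1 - s) *: d.1, (1 - s) *: d.2).
    by apply: in_dual_coneZ dK; rewrite subr_ge0.
  rewrite /r /D /cone_image /= -scalemxAr -scalemxAl -scalerDr -/(cone_image F d) -/D.
  by rewrite scalerBl scale1r scalerN [RHS]addrAC.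
have pr : psdmx r.
  split; first exact/symmetricmxP.
  move=> z; have := dir_cone (0, z *m z^T); rewrite /cone_image /= mulmx0 mul0mx add0r.
  rewrite innermxC innermx_gram big_ord1 col_id; apply; split => /=.
  - exact: trmx0.
  - by apply/lemx0P => i j; rewrite mxE.
  - exact: psdmx_gram.
have Fr : lemx 0 (F *m r *m F^T).
  apply/lemx0P => i j; set M := F *m r *m F^T.
  have MT : M^T = M by rewrite /M !trmx_mul trmxK rT mulmxA.
  have Mji : M j i = M i j by rewrite -{1}MT mxE.
  have := dir_cone (delta_mx i j + delta_mx j i, 0).
  rewrite /cone_image /= addr0 innermxC innermx_congr -/M innermxDl.
  have e p q : innermx (delta_mx p q) M = M p q.
    rewrite innermxE (bigD1 p) //= (bigD1 q) //= mxE !eqxx mul1r big1; last first.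
      by move=> l lq; rewrite mxE (negPf lq) andbF mul0r.
    rewrite big1 ?addr0 // => l lp; rewrite big1 // => l' _.
    by rewrite mxE (negPf lp) mul0r.
  rewrite !e Mji => H; suff : 0 <= M i j + M i j by lra.
  apply: H; split => /=.
  - by rewrite linearD /= !trmx_delta addrC.
  - by apply/lemx0P => p q; rewrite !mxE addr_ge0 ?ler0n.
  - exact: psdmx0.
exists d.1, d.2; split => //.
have r0 : r = 0.
  apply: innermx_le0_eq0; rewrite {2}/r innermxDr innermxNr.
  by have := C0 r pr Fr; rewrite innermxC; lra.
by apply/esym/eqP; rewrite -subr_eq0 -/(cone_image F d) -/D -/r r0.
Qed.

End Farkas.

(** * The relaxation in bordered form *)

Section Lift.
Variables (R : realType) (n : nat).
Implicit Types (t : R) (x h u v : 'cV[R]_n) (X W Y Z : 'M[R]_n).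
Local Notation e := (allones R n).

(** The corner t is kept free: t = 1 gives the points of the relaxation, t >= 0
    their homogenization, and other values the objective matrices. *)
Definition bordered t x X : 'M[R]_(1 + n) := block_mx t%:M x^T x X.

(** The rows are the coefficients, on (1, x), of the forms 1, x_i and 1 - x_i. *)
Definition rlt_factors : 'M[R]_(1 + (n + n), 1 + n) :=
  col_mx (row_mx 1%:M 0) (col_mx (row_mx 0 1%:M) (row_mx e (- 1%:M))).

Local Notation F := rlt_factors.

Lemma lemx0_block m1 m2 n1 n2 (A : 'M[R]_(m1, n1)) (B : 'M[R]_(m1, n2))
    (C : 'M[R]_(m2, n1)) (D : 'M[R]_(m2, n2)) :
  lemx 0 (block_mx A B C D) <-> [/\ lemx 0 A, lemx 0 B, lemx 0 C & lemx 0 D].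
Proof.
split=> [/lemx0P M0|[/lemx0P A0 /lemx0P B0 /lemx0P C0 /lemx0P D0]].
  split; apply/lemx0P => i j.
  - by have := M0 (lshift _ i) (lshift _ j); rewrite block_mxEul.
  - by have := M0 (lshift _ i) (rshift _ j); rewrite block_mxEur.
  - by have := M0 (rshift _ i) (lshift _ j); rewrite block_mxEdl.
  - by have := M0 (rshift _ i) (rshift _ j); rewrite block_mxEdr.
apply/lemx0P => i j.
case: (split_ordP i) => k ->; case: (split_ordP j) => l ->.
- by rewrite block_mxEul.
- by rewrite block_mxEur.
- by rewrite block_mxEdl.
- by rewrite block_mxEdr.
Qed.

Lemma lemx0_tr m p (A : 'M[R]_(m, p)) : lemx 0 A -> lemx 0 A^T.
Proof. by move=> /lemx0P A0; apply/lemx0P => i j; rewrite mxE. Qed.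

Lemma lemx0_row m p q (A : 'M[R]_(m, p)) (B : 'M[R]_(m, q)) :
  lemx 0 (row_mx A B) <-> lemx 0 A /\ lemx 0 B.
Proof.
split=> [/lemx0P M0|[/lemx0P A0 /lemx0P B0]].
  by split; apply/lemx0P => i j; [have := M0 i (lshift _ j); rewrite row_mxEl
    |have := M0 i (rshift _ j); rewrite row_mxEr].
apply/lemx0P => i j; case: (split_ordP j) => l ->.
  by rewrite row_mxEl.
by rewrite row_mxEr.
Qed.

Lemma lemx0_col m p q (A : 'M[R]_(p, m)) (B : 'M[R]_(q, m)) :
  lemx 0 (col_mx A B) <-> lemx 0 A /\ lemx 0 B.
Proof.
split=> [/lemx0_tr|[/lemx0_tr A0 /lemx0_tr B0]].
  by rewrite tr_col_mx => /lemx0_row [/lemx0_tr + /lemx0_tr]; rewrite !trmxK.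
by rewrite -[col_mx A B]trmxK; apply: lemx0_tr; rewrite tr_col_mx; apply/lemx0_row.
Qed.

Lemma rlt_products t x X :
  F *m bordered t x X *m F^T =
  block_mx t%:M (row_mx x^T (t *: e^T - x^T))
    (col_mx x (t *: e - x))
    (block_mx X (x *m e^T - X) (e *m x^T - X)
       (t *: (e *m e^T) - x *m e^T - e *m x^T + X)).
Proof.
have FB : F *m bordered t x X =
    col_mx (row_mx t%:M x^T) (col_mx (row_mx x X) (row_mx (t *: e - x) (e *m x^T - X))).
  rewrite !mul_col_mx !mul_row_block !mul1mx !mul0mx !addr0 !add0r.
  by rewrite mul_mx_scalar !mulNmx !mul1mx.
have FT : F^T = row_mx (col_mx 1%:M 0) (row_mx (col_mx 0 1%:M) (col_mx e^T (- 1%:M))).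
  by rewrite !tr_col_mx !tr_row_mx linearN /= !trmx0 !trmx1.
rewrite FB FT !mul_col_mx !mul_mx_row !mul_row_col.
rewrite !mulmx0 !mulmx1 !mulmxN !mulmx1 !addr0 !add0r mul_scalar_mx mulmxBl -scalemxAl.
rewrite opprD opprK addrA [RHS]block_mxEv; congr col_mx.
by rewrite -block_mxEv block_mxEh -block_mxEv.
Qed.

(** The adjoint of rlt_products: it shows that the multipliers u, v, W, Y, Z of the
    dual problem are the blocks of a single symmetric matrix L, and that
    F^T L F is the part of the dual constraints outside h and H. *)
Lemma rlt_combination (a : 'M[R]_1) u v W Y Z : W^T = W ->
  F^T *m block_mx a (row_mx v^T u^T) (col_mx v u) (block_mx Z Y^T Y W) *m F =
  block_mx (a + e^T *m u *+ 2 + e^T *m W *m e)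
    (- u + v - W *m e + Y^T *m e)^T (- u + v - W *m e + Y^T *m e)
    (W - Y - Y^T + Z).
Proof.
move=> WT.
have FT : F^T = row_mx (col_mx 1%:M 0) (row_mx (col_mx 0 1%:M) (col_mx e^T (- 1%:M))).
  by rewrite !tr_col_mx !tr_row_mx linearN /= !trmx0 !trmx1.
rewrite FT mul_row_block !mul_row_col !mul_mx_row !mul_col_mx.
rewrite !mul1mx !mul0mx !mulNmx !mul1mx !add_col_mx.
rewrite mulmx1 mulmx0 !add_row_mx !add_col_mx !add0r mul_row_col !mul_mx_row.
rewrite !add_row_mx !mulmxN !mulmx1 !mulmx0 !add0r mul_col_mx opp_col_mx !add_col_mx.
rewrite block_mxEh; congr (row_mx (col_mx _ _) (col_mx _ _)).
- have -> : e^T *m u = u^T *m e by rewrite -[RHS]mx11_tr trmx_mul trmxK.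
  by rewrite mulmxDl addrA mulr2n addrA.
- by rewrite mulmxBl; apply/matrixP => i j; rewrite !mxE; ring.
- rewrite !(linearD, linearN) /= !trmx_mul trmxK WT.
  by apply/matrixP => i j; rewrite !mxE; ring.
- by apply/matrixP => i j; rewrite !mxE; ring.
Qed.

Lemma innermx_bordered a t c x (Q X : 'M[R]_n) :
  innermx (bordered a c Q) (bordered t x X) =
  a * t + 2 * (c^T *m x) 0 0 + innermx Q X.
Proof.
rewrite /bordered innermx_block.
have -> : innermx (a%:M : 'M[R]_1) t%:M = a * t.
  by rewrite /innermx tr_scalar_mx -scalar_mxM mxtrace_scalar mulr1n.
have -> : innermx c x = (c^T *m x) 0 0 by rewrite /innermx /mxtrace big_ord1.
have -> : innermx c^T x^T = (c^T *m x) 0 0.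
  by rewrite /innermx trmxK mxtrace_mulC /mxtrace big_ord1 -[x^T *m c]mx11_tr trmx_mul trmxK.
ring.
Qed.

Lemma psdmx_borderedE (P : 'M[R]_(1 + n)) : psdmx P ->
  exists t x X, P = bordered t x X /\ 0 <= t.
Proof.
move=> pP; exists (P 0 0), (dlsubmx P), (drsubmx P).
have P00 : ulsubmx P = (P 0 0)%:M.
  apply/matrixP => i j; rewrite !ord1 !mxE; congr (P _ _); exact/val_inj.
split; last exact: psdmx_diag_ge0.
rewrite /bordered -P00 -[LHS]submxK; congr block_mx.
by rewrite trmx_dlsub (symmetricmxP _).1 //; case: pP.
Qed.

(** Completing the square: the form of the bordered matrix at (s, y) is
    (s + x^T y)^2 plus the form of X - x x^T at y. *)
Lemma psdmx_bordered1 x X : psdmx (bordered 1 x X) <-> psdmx (X - x *m x^T).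
Proof.
split=> [/psdmx_schur[_ _ _ _]|[sS S0]].
  by rewrite mxE eqxx mulr1n invr1 scale1r; apply; exact: ltr01.
have XT : X^T = X.
  move/symmetricmxP: sS; rewrite linearB /= trmx_mul trmxK => /eqP.
  by rewrite (inj_eq (addIr _)) => /eqP.
split; first by apply/symmetricmxP; rewrite tr_block_mx tr_scalar_mx trmxK XT.
move=> z; rewrite -[z]vsubmxK quad_block mxE eqxx mulr1n.
set s := usubmx z; set y := dsubmx z.
have := S0 y; rewrite mulmxBr mulmxBl addmx11 oppmx11.
have -> : (y^T *m (x *m x^T) *m y) 0 0 = (x^T *m y) 0 0 ^+ 2.
  rewrite mulmxA -mulmxA mulmx11 expr2; congr (_ * _).
  by rewrite -[y^T *m x]mx11_tr trmx_mul trmxK.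
by have := sqr_ge0 (s 0 0 + (x^T *m y) 0 0); lra.
Qed.

Lemma rlt_products_ge0 x X : X^T = X ->
  lemx 0 (F *m bordered 1 x X *m F^T) <->
  [/\ lemx 0 x, lemx 0 (e - x), lemx 0 X, lemx 0 (e *m x^T - X)
    & lemx 0 (e *m e^T - x *m e^T - e *m x^T + X)].
Proof.
move=> XT; rewrite rlt_products !scale1r; split.
  by move=> /lemx0_block[_ _ /lemx0_col[? ?] /lemx0_block[? _ ? ?]].
move=> [x0 x1 X0 xX wX]; apply/lemx0_block; split.
- by apply/lemx0P => i j; rewrite !ord1 mxE.
- by apply/lemx0_row; split; [|rewrite -linearB]; exact: lemx0_tr.
- exact/lemx0_col.
- apply/lemx0_block; split => //.
  by move: (lemx0_tr xX); rewrite linearB /= trmx_mul trmxK XT.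
Qed.

(** The constraints of the relaxation range over i <= j only, and symmetry of X
    extends them to all pairs. *)
Lemma FRS_bordered x X :
  FRS (x, X) <-> psdmx (bordered 1 x X) /\ lemx 0 (F *m bordered 1 x X *m F^T).
Proof.
have sXP : psdmx (X - x *m x^T) -> X^T = X.
  move=> [/symmetricmxP + _]; rewrite linearB /= trmx_mul trmxK => /eqP.
  by rewrite (inj_eq (addIr _)) => /eqP.
have entries : [/\ lemx 0 x, lemx 0 (e - x), lemx 0 X, lemx 0 (e *m x^T - X)
    & lemx 0 (e *m e^T - x *m e^T - e *m x^T + X)] <->
    [/\ forall i, 0 <= x i 0 <= 1
      & forall i j, [/\ 0 <= X i j, X i j <= x j 0 & x i 0 + x j 0 - 1 <= X i j]].
  split=> [[/lemx0P x0 /lemx0P x1 /lemx0P X0 /lemx0P xX /lemx0P wX]|[x01 bX]].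
    split=> [i|i j].
      by rewrite x0 /=; have := x1 i 0; rewrite !mxE subr_ge0.
    split=> //; first by have := xX i j; rewrite !mxE big_ord1 !mxE; lra.
    by have := wX i j; rewrite !mxE !big_ord1 !mxE; lra.
  split; apply/lemx0P => i j.
  - by rewrite ord1; have /andP[] := x01 i.
  - by rewrite ord1 !mxE subr_ge0; have /andP[] := x01 i.
  - by have [] := bX i j.
  - by have [_ + _] := bX i j; rewrite !mxE big_ord1 !mxE; lra.
  - by have [_ _] := bX i j; rewrite !mxE !big_ord1 !mxE; lra.
split=> [[[sX [x0 x1] Xx] /= pX]|[/psdmx_bordered1 pX]].
  have XT := sXP pX; have XE i j : X j i = X i j by rewrite -{1}XT mxE.
  split; [exact/psdmx_bordered1|apply/rlt_products_ge0 => //; apply/entries].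
  split=> [i|i j].
    by have := x0 i 0; have := x1 i 0; rewrite !mxE => -> ->.
  wlog ij : i j / (i <= j)%N.
    move=> H; have [/H //|/ltnW ji] := leqP i j.
    have := Xx j i ji; rewrite ge_max le_min XE => /andP[/andP[? ?] /andP[? ?]].
    by split => //; rewrite [x i 0 + _]addrC.
  by have := Xx i j ij; rewrite ge_max le_min => /andP[/andP[? ?] /andP[? ?]].
have XT := sXP pX; have XE i j : X j i = X i j by rewrite -{1}XT mxE.
move=> /(rlt_products_ge0 x XT)/entries[x01 bX]; split => //; split => /=.
- exact/symmetricmxP.
- by split => i j; rewrite ord1 mxE; have /andP[] := x01 i.
- move=> i j _; have [X0 Xj w] := bX i j; have [_ Xi _] := bX j i.
  by rewrite ge_max le_min X0 w Xj -XE Xi.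
Qed.

(** For w = (2, e) every form 1, x_i, 1 - x_i is at least 1 after
    homogenization, so w w^T satisfies all product constraints strictly; adding
    the identity makes it positive definite, and the factor 2 absorbs the entries
    -1 of F F^T. *)
Lemma rlt_slater : exists2 P : 'M[R]_(1 + n),
  psdmx (P - 1%:M) & lemx (const_mx 1) (F *m P *m F^T).
Proof.
pose w : 'cV[R]_(1 + n) := col_mx 2%:M e.
exists (2 *: (w *m w^T) + 1%:M).
  by rewrite addrK; apply: psdmxZ => //; exact: psdmx_gram.
have Fw i : 1 <= (F *m w) i 0.
  have -> : F *m w = col_mx 2%:M (col_mx e e).
    rewrite !mul_col_mx !mul_row_col !mul0mx !mul1mx addr0 add0r mulNmx mul1mx.
    by rewrite mul_mx_scalar scaler_nat mulr2n addrK.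
  case: (split_ordP i) => k ->; first by rewrite col_mxEu !ord1 mxE mulr1n ler1n.
  by rewrite col_mxEd; case: (split_ordP k) => l ->; rewrite ?col_mxEu ?col_mxEd mxE.
have F1 i j : - 1 <= (F *m 1%:M *m F^T) i j.
  have -> : 1%:M = bordered 1 0 1%:M by rewrite /bordered trmx0 -scalar_mx_block.
  rewrite rlt_products scale1r.
  have b01 (b : bool) : 0 <= b%:R :> R /\ b%:R <= 1 :> R by case: b.
  (* In each of the nine blocks the entry is a constant plus or minus [i == j]. *)
  by case: (split_ordP i) => {i}i ->; [|case: (split_ordP i) => {}i ->];
     (case: (split_ordP j) => {j}j ->; [|case: (split_ordP j) => {}j ->]);
     rewrite ?(block_mxEul, block_mxEur, block_mxEdl, block_mxEdr)
       ?(row_mxEl, row_mxEr) ?(col_mxEu, col_mxEd) !mxE ?big_ord1 ?mxE;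
     have := b01 (i == j :> nat); rewrite -?val_eqE /=; lra.
move=> i j; rewrite mxE mulmxDr mulmxDl mxE -scalemxAr -scalemxAl [X in _ <= X + _]mxE.
have -> : F *m (w *m w^T) *m F^T = (F *m w) *m (F *m w)^T by rewrite trmx_mul !mulmxA.
rewrite [X in _ <= _ * X + _]mxE big_ord1 [(F *m w)^T _ _]mxE.
by have := Fw i; have := Fw j; have := F1 i j; nra.
Qed.

End Lift.

(** * Duality for the relaxation *)

Section Duality.
Variables (R : realType) (n : nat) (Q : 'M[R]_n) (c : 'cV[R]_n).
Implicit Types (p : 'cV[R]_n * 'M[R]_n).
Local Notation e := (allones R n).
Local Notation F := (rlt_factors R n).

Lemma innermx_objective a p :
  innermx (bordered a c Q) (bordered 1 p.1 p.2) = a + 2 * RS_obj Q c p.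
Proof. by rewrite innermx_bordered /RS_obj; field. Qed.

(** The feasible set is compact: X_ii <= x_i <= 1 bounds the trace of the bordered
    matrix by 1 + n. *)
Lemma primal_attained : exists2 p, @FRS R n p &
  forall q, @FRS R n q -> RS_obj Q c p <= RS_obj Q c q.
Proof.
pose K := [set P : 'M[R]_(1 + n) | psdmx P] `&`
  ([set P : 'M[R]_(1 + n) | P (lshift n 0) (lshift n 0) - 1 = 0] `&`
   [set P | lemx 0 (F *m P *m F^T)]).
have FRSK p : FRS p -> K (bordered 1 p.1 p.2).
  case: p => x X /FRS_bordered[pP FP]; split => //; split => //.
  by rewrite /= /bordered block_mxEul mxE eqxx subrr.
have KFRS P : K P -> exists2 p, FRS p & P = bordered 1 p.1 p.2.
  move=> [pP [/= P00 FP]]; have [t [x [X [PE _]]]] := psdmx_borderedE pP.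
  have t1 : t = 1.
    move: P00; rewrite PE /bordered block_mxEul mxE eqxx mulr1n => /eqP.
    by rewrite subr_eq0 => /eqP.
  by exists (x, X); rewrite ?PE ?t1 //; apply/FRS_bordered; rewrite -t1 -PE.
have Kc : compact K.
  apply: (@compact_mx _ _ _ _ (1 + n%:R)) => [|P KP i j].
    apply: closedI; first exact: closed_psdmx.
    apply: closedI.
      apply: closed_eq0 => P; apply: continuousB; last exact: cst_continuous.
      exact: coord_continuous.
    apply: (@preimage_closed _ _ (fun P => F *m P *m F^T) [set A | lemx 0 A]).
      move=> P _; apply: continuous_mulmx; last exact: cst_continuous.
      by apply: continuous_mulmx => ?; [exact: cst_continuous|exact: cvg_id].
    exact: closed_lemx0.
  have [pP _] := KP; rewrite (le_trans (psdmx_entry_le i j pP)) //.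
  have [[x X] [[_ [_ x1] bX] _] ->] := KFRS P KP.
  rewrite /bordered mxtrace_block mxtrace_scalar mulr1n lerD2l.
  have -> : (n%:R : R) = \sum_(i < n) 1 by rewrite sumr_const card_ord.
  apply: ler_sum => k _; have := bX k k (leqnn _); rewrite le_min => /and3P[_ + _].
  by move=> /le_trans; apply; have := x1 k 0; rewrite !mxE.
have K0 : K !=set0.
  exists (bordered 1 0 0); apply: (FRSK (0, 0)); split => /=.
    split; [by apply/symmetricmxP; exact: trmx0|by split=> i j; rewrite !mxE|].
    by move=> i j _; rewrite !mxE ge_max le_min addr0 sub0r lexx oppr_le0 ler01.
  by rewrite mul0mx subr0; exact: psdmx0.
have objc : continuous (innermx (bordered 0 c Q)).
  by apply: continuous_innermx => ?; [exact: cst_continuous|exact: cvg_id].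
have [P] := compact_EVT_min K0 Kc (continuous_subspaceT objc).
rewrite inE => /KFRS[p pF ->] pmin; exists p => // q /FRSK qK.
by have := pmin _ (mem_set qK); rewrite !innermx_objective !add0r; lra.
Qed.

(** The duality gap is half the sum of two nonnegative terms, <L, F P F^T> for
    the linear constraints and <G, P> for the semidefinite one. *)
Lemma weak_duality (d : RSD_var R n) p :
  RSD_feasible Q c d -> FRS p -> RSD_obj d <= RS_obj Q c p.
Proof.
case: d => u v W Y Z beta h H [[/symmetricmxP WT sZ sH] hc hQ [u0 v0 W0 Y0 Z0] pG].
case: p => x X /FRS_bordered[pP FP]; set d := RSDVar _ _ _ _ _ _ _ _.
pose L : 'M[R]_(1 + (n + n)) :=
  block_mx 0 (row_mx v^T u^T) (col_mx v u) (block_mx Z Y^T Y W).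
have ME : bordered (- 2 * RSD_obj d) c Q = F^T *m L *m F + bordered beta h H.
  rewrite /L rlt_combination // /bordered add_block_mx; congr block_mx.
  - apply/matrixP => i j; rewrite !ord1 /RSD_obj /=.
    by rewrite mulr2n !addmx11 !mxE !eqxx !mulr1n; field.
  - by rewrite -hc [LHS]linearD.
  - by rewrite hc.
  - by rewrite -hQ; apply/matrixP => i j; rewrite !mxE; ring.
have L0 : lemx 0 L.
  apply/lemx0_block; split.
  - by apply/lemx0P => i j; rewrite mxE.
  - by apply/lemx0_row; split; exact: lemx0_tr.
  - exact/lemx0_col.
  - by apply/lemx0_block; split => //; exact: lemx0_tr.
have := innermx_objective (- 2 * RSD_obj d) (x, X).
rewrite ME innermxDl innermx_congr.
have := innermx_nonneg L0 FP; have := innermx_psdmx_ge0 pG pP; rewrite /bordered /=; lra.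
Qed.

(** The multipliers come from conic_farkas at [-2l, c^T; c, Q], with l the primal
    minimum.  The multiplier a of the product of the form 1 with itself has no
    counterpart in the dual problem; it is absorbed into beta. *)
Lemma dual_attained p : Q \is symmetricmx -> FRS p ->
  (forall q, FRS q -> RS_obj Q c p <= RS_obj Q c q) ->
  exists2 d, RSD_feasible Q c d & RSD_obj d = RS_obj Q c p.
Proof.
move=> /symmetricmxP QT pF pmin; set l := RS_obj Q c p.
have [Ps Ps1 FPs] := rlt_slater R n.
have := pF; rewrite [p]surjective_pairing => /FRS_bordered[pp Fp].
have [||L [G [LT L0 pG ME]]] := @conic_farkas _ _ _ F (bordered (- 2 * l) c Q) Ps Ps1 FPs.
- by rewrite /bordered tr_block_mx tr_scalar_mx trmxK QT.
- move=> P pP FP; have [t [x [X [PE t0]]]] := psdmx_borderedE pP.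
  have t1 : 0 < t + 1 by rewrite ltr_wpDl.
  (* P may have corner 0; the sum of P and the optimal bordered matrix rescales to
     a feasible point q, and the optimal one has inner product 0 with the
     objective matrix. *)
  pose q := ((t + 1)^-1 *: (x + p.1), (t + 1)^-1 *: (X + p.2)).
  have qE : bordered 1 q.1 q.2 = (t + 1)^-1 *: (P + bordered 1 p.1 p.2).
    rewrite PE /bordered add_block_mx scale_block_mx; congr block_mx.
    - by rewrite -raddfD /= scale_scalar_mx mulVf ?gt_eqF.
    - by rewrite -linearD -linearZ.
  have ti : 0 <= (t + 1)^-1 by rewrite invr_ge0 ltW.
  have qF : FRS q.
    apply/FRS_bordered; rewrite qE; split; first by apply: psdmxZ => //; exact: psdmxD.
    rewrite -scalemxAr -scalemxAl mulmxDr mulmxDl; apply/lemx0P => i j.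
    by rewrite 2!mxE mulr_ge0 // addr_ge0 //; exact/(lemx0P _).1.
  have := pmin q qF; have := innermx_objective (- 2 * l) q.
  rewrite qE innermxZr innermxDr innermx_objective -/l => + lq.
  have -> : - 2 * l + 2 * l = 0 by ring.
  rewrite addr0 => qv.
  rewrite -(pmulr_rge0 _ (_ : 0 < (t + 1)^-1)) ?invr_gt0 // qv; lra.
pose Z := @ulsubmx R n n n n (drsubmx L); pose Y := @dlsubmx R n n n n (drsubmx L).
pose W := @drsubmx R n n n n (drsubmx L).
pose v := @usubmx R n n 1 (dlsubmx L); pose u := @dsubmx R n n 1 (dlsubmx L).
pose a := ulsubmx L 0 0.
have drT : (drsubmx L)^T = drsubmx L by rewrite trmx_drsub LT.
have LE : L = block_mx a%:M (row_mx v^T u^T) (col_mx v u) (block_mx Z Y^T Y W).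
  rewrite -[LHS]submxK; congr block_mx.
  - by apply/matrixP => i j; rewrite !ord1 [RHS]mxE eqxx mulr1n.
  - by rewrite -tr_col_mx vsubmxK trmx_dlsub LT.
  - by rewrite vsubmxK.
  - by rewrite -[LHS]submxK; congr block_mx; rewrite trmx_dlsub drT.
have [g [h [H [GE g0]]]] := psdmx_borderedE pG.
have WT : W^T = W by rewrite /W trmx_drsub drT.
have ZT : Z^T = Z by rewrite /Z trmx_ulsub drT.
have HT : H^T = H.
  by have [/symmetricmxP + _] := pG; rewrite GE tr_block_mx => /eq_block_mx[].
move: L0; rewrite LE => /lemx0_block[/lemx0P a0 _ /lemx0_col[v0 u0] /lemx0_block[Z0 _ Y0 W0]].
have {}a0 : 0 <= a by have := a0 0 0; rewrite mxE.
move: ME; rewrite LE rlt_combination // GE /bordered add_block_mx.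
move=> /eq_block_mx[/matrixP/(_ 0 0) l00 _ cE QE].
exists (RSDVar u v W Y Z (a + g) h H).
  split; [by split; exact/symmetricmxP|by []| |by split|].
    by rewrite QE; apply/matrixP => i j; rewrite !mxE; ring.
  have -> : block_mx (a + g)%:M h^T h H = G + block_mx a%:M 0^T 0 0.
    by rewrite GE /bordered add_block_mx trmx0 !addr0 -raddfD addrC.
  apply: psdmxD => //; split.
    by apply/symmetricmxP; rewrite tr_block_mx tr_scalar_mx trmxK !trmx0.
  move=> z; rewrite -[z]vsubmxK quad_block trmx0 mulmx0 !mul0mx mxE eqxx mulr1n.
  by rewrite [(0 : 'M[R]_1) 0 0]mxE mulr0 !addr0 mulr_ge0 ?sqr_ge0.
move: l00; rewrite /RSD_obj /= [e^T *m u *+ 2]mulr2n !addmx11 [(_%:M) 0 0]mxE [(a%:M) 0 0]mxE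
  [(g%:M) 0 0]mxE eqxx !mulr1n; lra.
Qed.

End Duality.

Theorem lemma5p2 (R : realType) (n : nat) (hn : (0 < n)%N)
    (Q : 'M[R]_n) (c : 'cV[R]_n) (hQ : Q \is symmetricmx) :
  [/\ RS_value Q c = RSD_value Q c,
      exists2 p, @FRS R n p & (RS_obj Q c p)%:E = RS_value Q c
    & exists2 d, RSD_feasible Q c d & (RSD_obj d)%:E = RSD_value Q c].
Proof.
have [p pF pmin] := primal_attained Q c.
have [d dF dE] := dual_attained hQ pF pmin.
have pV : RS_value Q c = (RS_obj Q c p)%:E.
  apply/eqP; rewrite eq_le; apply/andP; split.
    by apply: ereal_inf_lbound; exists p.
  by apply: le_ereal_inf_tmp => _ [q qF <-]; rewrite lee_fin; exact: pmin.
have dV : RSD_value Q c = (RSD_obj d)%:E.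
  apply/eqP; rewrite eq_le; apply/andP; split.
    by apply: ge_ereal_sup => _ [d' dF' <-]; rewrite lee_fin dE; exact: weak_duality.
  by apply: ereal_sup_ubound; exists d.
by split; [rewrite pV dV dE|exists p|exists d].
Qed.
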